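(* If $\mathcal{W}$ is an $m$-dimensional subspace of $\mathbb{C}^n$ with orthonormal basis $W$ (that is, $W\in\mathbb{C}^{n\times m}$ has orthonormal columns spanning $\mathcal{W}$) and $J\in\mathbb{C}^{n\times q}$, where $m\ge q$, with $\mathcal{J}:=\operatorname{Range}J$, then $$\eta(\mathcal{W},\mathcal{J}):=\frac{\det([J^*J]^{-1})}{\det([J^*WW^*J]^{-1})}=\prod_{k=1}^{q}\cos^2\phi_k(\mathcal{W},\mathcal{J}),$$ where $\phi_k(\mathcal{A},\mathcal{B})$ is the $k$th principal angle (canonical subspace angle) between $\mathcal{A},\mathcal{B}\subset\mathbb{C}^n$.
   Context: Canonical subspace angles: if $\mathcal{A}$ and $\mathcal{B}$ are two subspaces of $\mathbb{C}^n$ and $A\in\mathbb{C}^{n\times m_a}$ and $B\in\mathbb{C}^{n\times m_b}$ are orthonormal bases for $\mathcal{A}$ and $\mathcal{B}$ (their columns are orthonormal and span the respective subspaces), then the canonical subspace angles $\phi_k(\mathcal{A},\mathcal{B})$ between $\mathcal{A}$ and $\mathcal{B}$ are defined by $$\cos\phi_k(\mathcal{A},\mathcal{B}):=\sigma_k(A^*B),\qquad 0\le\phi_1(\mathcal{A},\mathcal{B})\le\phi_2(\mathcal{A},\mathcal{B})\le\cdots\le\phi_{\min\{m_a,m_b\}}(\mathcal{A},\mathcal{B})\le\pi/2,$$ where $\sigma_k(X)$ is the $k$th singular value of $X$ in descending order. Here $X^*$ denotes the conjugate transpose of $X$. The quantity $\eta(\mathcal{W},\mathcal{J})$ is called the (linearized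 D-)efficiency. *)

(* Defs.v *)
From mathcomp Require Import all_boot all_order all_algebra spectral complex.
From mathcomp Require Import boolp classical_sets reals trigo.
Set Implicit Arguments.
Unset Strict Implicit.
Unset Printing Implicit Defensive.
Import Order.TTheory GRing.Theory Num.Theory.
Local Open Scope ring_scope.
Local Open Scope complex_scope.
Local Open Scope sesquilinear_scope.

Definition colspace (F : fieldType) (n m : nat) (A : 'M[F]_(n, m)) :
    {vspace 'cV[F]_n} :=
  <<[tuple col j A | j < m]>>%VS.

Definition orthonormal_basis (C : numClosedFieldType) (n m : nat)
    (U : {vspace 'cV[C]_n}) (A : 'M[C]_(n, m)) : Prop :=
  A^t* *m A = 1%:M /\ colspace A = U.

(* For normal A, spectral_diag A lists the eigenvalues of A with multiplicity;
   those of X^* X are real and nonnegative. A p x q matrix has min(p, q)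
   singular values, while X^* X may have extra zero eigenvalues. *)
Definition singular_values (R : realType) (p q : nat) (X : 'M[R[i]]_(p, q)) :
    seq R :=
  take (minn p q)
    (sort >=%R [seq Num.sqrt (complex.Re (spectral_diag (X^t* *m X) 0 i))
               | i <- enum 'I_q]).

(* Indices start at 0, and the value is 0 beyond the last singular value. *)
Definition singular_value (R : realType) (p q : nat) (k : nat)
    (X : 'M[R[i]]_(p, q)) : R :=
  (singular_values X)`_k.

Definition some_orthonormal_basis (R : realType) (n : nat)
    (U : {vspace 'cV[R[i]]_n}) : 'M[R[i]]_(n, \dim U) :=
  xget 0 [set A | orthonormal_basis U A]%classic.

(* The angles do not depend on the chosen bases: see cos_subspace_angle.
   Indices start at 0; the meaningful ones are k < min(dim U, dim V), and the
   value is pi / 2 beyond. *)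
Definition subspace_angle (R : realType) (n : nat) (k : nat)
    (U V : {vspace 'cV[R[i]]_n}) : R :=
  acos (singular_value k
    ((some_orthonormal_basis U)^t* *m some_orthonormal_basis V)).

(* When J^* W W^* J is singular, its invmx has determinant 0, so the quotient
   is 0: the usual convention that the denominator is then infinite. *)
Definition efficiency (C : numClosedFieldType) (n m q : nat)
    (W : 'M[C]_(n, m)) (J : 'M[C]_(n, q)) : C :=
  \det (invmx (J^t* *m J)) / \det (invmx (J^t* *m W *m W^t* *m J)).

Lemma colspaceP (F : fieldType) n m (A : 'M[F]_(n, m)) (v : 'cV_n) :
  reflect (exists x : 'cV_m, v = A *m x) (v \in colspace A).
Proof.
have colE (x : 'cV_m) : A *m x = \sum_j x j 0 *: col j A.
  apply/colP => i; rewrite mxE summxE; apply: eq_bigr => j _.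
  by rewrite !mxE mulrC.
apply: (iffP idP) => [vA | [x ->]].
  exists (\col_j coord [tuple col j A | j < m] j v).
  rewrite colE [LHS](coord_span vA); apply: eq_bigr => j _.
  by rewrite !mxE -tnth_nth tnth_mktuple.
rewrite colE; apply: memv_suml => j _; apply/memvZ/memv_span.
by apply/tnthP; exists j; rewrite tnth_mktuple.
Qed.

Lemma colspace_sub (F : fieldType) n m p (A : 'M[F]_(n, m)) (B : 'M_(n, p)) :
  (colspace A <= colspace B)%VS <-> exists X, A = B *m X.
Proof.
split=> [/subvP sAB | [X ->]]; last first.
  by apply/subvP => v /colspaceP[x ->]; apply/colspaceP; exists (X *m x); rewrite mulmxA.
have /choice[x xE] j : exists x : 'cV_p, col j A = B *m x.
  by apply/colspaceP/sAB/colspaceP; exists (delta_mx j 0); rewrite colE.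
exists (\matrix_(i, j) x j i 0); apply/matrixP => i j.
have := congr1 (fun v : 'cV_n => v i 0) (xE j); rewrite !mxE => ->.
by apply: eq_bigr => k _; rewrite mxE.
Qed.

Lemma trmxC_mul (C : numClosedFieldType) n m p (A : 'M[C]_(n, m))
  (B : 'M_(m, p)) : (A *m B)^t* = B^t* *m A^t*.
Proof. by rewrite trmx_mul map_mxM. Qed.

Lemma trmxC_sub (C : numClosedFieldType) n m (A B : 'M[C]_(n, m)) :
  (A - B)^t* = A^t* - B^t*.
Proof. by apply/matrixP => i j; rewrite !mxE rmorphB. Qed.

Lemma orthonormal_basis_exists (C : numClosedFieldType) n
  (U : {vspace 'cV[C]_n}) : exists A : 'M_(n, \dim U), orthonormal_basis U A.
Proof.
pose N : 'M_(n, \dim U) := \matrix_(i, j) tnth (vbasis U) j i 0.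
have colN j : col j N = tnth (vbasis U) j.
  by apply/colP => i; rewrite !mxE.
have NU : colspace N = U.
  rewrite /colspace; have -> : [tuple col j N | j < \dim U] = vbasis U.
    by apply: eq_from_tnth => j; rewrite tnth_mktuple colN.
  exact: span_basis (vbasisP U).
have dU : (\dim U <= n)%N.
  by have := dimvS (subvf U); rewrite dimvf /dim /= muln1.
have freeN : row_free N^T.
  rewrite -kermx_eq0; apply/eqP/row_matrixP => i; rewrite row0.
  set u := row i _.
  have uN : u *m N^T = 0.
    by rewrite /u -row_mul mulmx_ker row0.
  have sum0 : \sum_j u 0 j *: (vbasis U)`_j = 0.
    apply/colP => k; rewrite summxE [RHS]mxE.
    have := congr1 (fun M : 'rV_n => M 0 k) uN; rewrite [RHS]mxE => uN0.
    rewrite -[RHS]uN0 mxE.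
    by apply: eq_bigr => j _; rewrite !mxE (tnth_nth 0).
  have /freeP/(_ _ sum0) u0 := basis_free (vbasisP U).
  by apply/rowP => j; rewrite u0 mxE.
exists (schmidt N^T)^T; split.
  have /unitarymxP H := schmidt_unitarymx N^T dU.
  by rewrite -[RHS]trmx1 -H trmx_mul -!map_trmx !trmxK.
have E := eqmx_schmidt_free freeN.
apply: etrans NU; apply/eqP; rewrite eqEsubv; apply/andP; split; apply/colspace_sub.
  have /submxP[D DE] : (schmidt N^T <= N^T)%MS by rewrite E.
  by exists D^T; rewrite DE trmx_mul trmxK.
have /submxP[D DE] : (N^T <= schmidt N^T)%MS by rewrite E.
by exists D^T; rewrite -trmx_mul -DE trmxK.
Qed.

Lemma orthonormal_basis_dim (C : numClosedFieldType) n m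
  (U : {vspace 'cV[C]_n}) (A : 'M_(n, m)) : orthonormal_basis U A -> \dim U = m.
Proof.
move=> [AA <-]; rewrite /colspace.
have /eqP -> : free [tuple col j A | j < m]; last by rewrite size_tuple.
apply/freeP => k k0.
have A0 : A *m (\col_j k j) = 0.
  rewrite -k0; apply/colP => i; rewrite mxE summxE; apply: eq_bigr => j _.
  by rewrite !mxE -tnth_nth tnth_mktuple mxE mulrC.
move=> i; have : (A^t* *m (A *m \col_j k j)) i 0 = 0 by rewrite A0 mulmx0 mxE.
by rewrite mulmxA AA mul1mx mxE.
Qed.

Lemma orthonormal_basis_unitary (C : numClosedFieldType) n m
  (U : {vspace 'cV[C]_n}) (A B : 'M_(n, m)) :
  orthonormal_basis U A -> orthonormal_basis U B ->
  exists2 X, A = B *m X & X \is unitarymx.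
Proof.
move=> [AA AU] [BB BU].
have /colspace_sub[X AE] : (colspace A <= colspace B)%VS by rewrite AU BU.
exists X => //; apply/unitarymxP/mulmx1C; rewrite -[RHS]AA AE trmxC_mul.
by rewrite mulmxA -(mulmxA _ (B^t*)) BB mulmx1.
Qed.


Lemma char_poly_conj (C : comNzRingType) n (P Q D : 'M[C]_n) : Q *m P = 1%:M ->
  char_poly (Q *m D *m P) = char_poly D.
Proof.
move=> QP; rewrite /char_poly.
have Pm : map_mx polyC Q *m map_mx polyC P = 1%:M.
  by rewrite -map_mxM QP map_mx1.
have -> : char_poly_mx (Q *m D *m P) =
   map_mx polyC Q *m char_poly_mx D *m map_mx polyC P.
  rewrite /char_poly_mx mulmxBr mulmxBl !map_mxM scalar_mxC -(mulmxA 'X%:M).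
  by rewrite Pm mulmx1.
by rewrite !det_mulmx mulrAC -det_mulmx Pm det1 mul1r.
Qed.

Lemma gram_normal (C : numClosedFieldType) p q (X : 'M[C]_(p, q)) :
  X^t* *m X \is normalmx.
Proof. by apply/normalmxP; rewrite trmxC_mul trmxCK. Qed.

Lemma char_poly_spectral (C : numClosedFieldType) n (A : 'M[C]_n) :
  A \is normalmx ->
  char_poly A = \prod_(x <- [seq spectral_diag A 0 i | i <- enum 'I_n])
                   ('X - x%:P).
Proof.
move=> /orthomx_spectralP nA; rewrite {1}nA char_poly_conj; last first.
  by rewrite mulVmx // spectral_unit.
rewrite char_poly_trig ?diag_mx_is_trig // big_map big_enum /=.
by apply: eq_bigr => i _; rewrite mxE eqxx.
Qed.

Lemma spectral_diag_perm (C : numClosedFieldType) n (A B : 'M[C]_n) :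
  A \is normalmx -> B \is normalmx -> char_poly A = char_poly B ->
  perm_eq [seq spectral_diag A 0 i | i <- enum 'I_n]
          [seq spectral_diag B 0 i | i <- enum 'I_n].
Proof.
by move=> nA nB AB; apply: prod_XsubC_eq; rewrite -!char_poly_spectral.
Qed.

Lemma singular_values_unitary (R : realType) p q (X : 'M[R[i]]_(p, q))
  (S : 'M_p) (T : 'M_q) :
  S \is unitarymx -> T \is unitarymx ->
  singular_values (S *m X *m T) = singular_values X.
Proof.
move=> uS uT; rewrite /singular_values; congr take.
apply/perm_sortP.
- by move=> x y; exact: ge_total.
- by move=> y x z xy yz; exact: le_trans yz xy.
- by move=> x y; rewrite andbC; exact: le_anti.
pose g (z : R[i]) := Num.sqrt (complex.Re z).
have mapg (Y : 'M[R[i]]_(p, q)) :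
    [seq g (spectral_diag (Y^t* *m Y) 0 i) | i <- enum 'I_q] =
    map g [seq spectral_diag (Y^t* *m Y) 0 i | i <- enum 'I_q].
  by elim: (enum _) => //= a s ->.
rewrite !mapg; apply/perm_map/spectral_diag_perm; rewrite ?gram_normal //.
have SS : S^t* *m S = 1%:M by apply/mulmx1C/unitarymxP.
have TT : T^t* *m T = 1%:M by apply/mulmx1C/unitarymxP.
rewrite -[RHS](char_poly_conj _ TT) !trmxC_mul; congr char_poly.
by rewrite !mulmxA -(mulmxA _ (S^t*)) SS mulmx1.
Qed.

Lemma gram_diag_ge0 (C : numClosedFieldType) p q (X : 'M[C]_(p, q)) i :
  0 <= (X^t* *m X) i i.
Proof.
by rewrite mxE sumr_ge0 // => j _; rewrite !mxE mulrC mul_conjC_ge0.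
Qed.

Lemma singular_value_itv (R : realType) n p q k (A : 'M[R[i]]_(n, p))
  (B : 'M[R[i]]_(n, q)) : A^t* *m A = 1%:M -> B^t* *m B = 1%:M ->
  0 <= singular_value k (A^t* *m B) <= 1.
Proof.
move=> AA BB; rewrite /singular_value.
have all01 : {in singular_values (A^t* *m B), forall x : R, 0 <= x <= 1}.
  move=> x /mem_take; rewrite mem_sort => /mapP[i _ ->].
  rewrite sqrtr_ge0 -[X in _ <= X]sqrtr1 ler_wsqrtr //.
  set X := A^t* *m B.
  have /orthomx_spectralP := gram_normal X.
  set P := spectralmx _; set d := spectral_diag _ => XE.
  have uP : P \is unitarymx := spectral_unitarymx _.
  rewrite (invmx_unitary uP) in XE.
  have PP : P *m P^t* = 1%:M by apply/unitarymxP.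
  have dE : diag_mx d = P *m (X^t* *m X) *m P^t*.
    by rewrite XE !mulmxA PP mul1mx -mulmxA PP mulmx1.
  pose Y := (B - A *m A^t* *m B) *m P^t*.
  have YE : Y^t* *m Y = 1%:M - diag_mx d.
    have -> : 1%:M = P *m (B^t* *m B) *m P^t* by rewrite BB mulmx1 PP.
    rewrite dE /Y trmxC_mul trmxCK -mulmxBl -mulmxBr !mulmxA; congr (_ *m _).
    rewrite -!mulmxA; congr (_ *m _).
    rewrite trmxC_sub !trmxC_mul trmxCK mulmxBl !mulmxBr.
    rewrite !mulmxA -(mulmxA _ (A^t*) A) AA mulmx1 subrr subr0.
    by [].
  have := gram_diag_ge0 Y i; rewrite YE !mxE eqxx mulr1n subr_ge0.
  by rewrite lecE => /andP[].
have [kS|kS] := ltnP k (size (singular_values (A^t* *m B))).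
  exact/all01/mem_nth.
by rewrite nth_default // lexx ler01.
Qed.

Lemma some_orthonormal_basisP (R : realType) n (U : {vspace 'cV[R[i]]_n}) :
  orthonormal_basis U (some_orthonormal_basis U).
Proof.
by rewrite /some_orthonormal_basis; case: xgetP => [A _ //|] H;
  have [A /H] := orthonormal_basis_exists U.
Qed.

Lemma cos_subspace_angle (R : realType) n ma mb k
    (U V : {vspace 'cV[R[i]]_n}) (A : 'M_(n, ma)) (B : 'M_(n, mb)) :
  orthonormal_basis U A -> orthonormal_basis V B ->
  cos (subspace_angle k U V) = singular_value k (A^t* *m B).
Proof.
move=> UA VB; move: (orthonormal_basis_dim UA) (orthonormal_basis_dim VB).
move=> ? ?; subst ma mb.
have [U0 V0] := (some_orthonormal_basisP U, some_orthonormal_basisP V).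
rewrite acosK; last first.
  have /andP[x0 x1] := singular_value_itv k U0.1 V0.1.
  by rewrite in_itv /= x1 andbT (le_trans _ x0) // lerN10.
have [S -> uS] := orthonormal_basis_unitary U0 UA.
have [T -> uT] := orthonormal_basis_unitary V0 VB.
rewrite /singular_value trmxC_mul !mulmxA -(mulmxA _ (A^t*)).
by rewrite singular_values_unitary // trmxC_unitary.
Qed.

Lemma subspace_angle_itv (R : realType) n k (U V : {vspace 'cV[R[i]]_n}) :
  0 <= subspace_angle k U V <= pi / 2.
Proof.
have [U0 V0] := (some_orthonormal_basisP U, some_orthonormal_basisP V).
have /andP[x0 x1] := singular_value_itv k U0.1 V0.1.
rewrite /subspace_angle; set s := singular_value _ _ in x0 x1 *.
have s1 : -1 <= s <= 1 by rewrite x1 andbT (le_trans _ x0) // lerN10.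
rewrite acos_ge0 //= leNgt -ltr_cos ?in_itv /=.
- by rewrite acosK ?in_itv //= cos_pihalf -leNgt.
- by rewrite divr_ge0 ?pi_ge0 //= ler_pdivrMr // ler_peMr ?pi_ge0 ?ler1n.
- by rewrite acos_ge0 ?acos_lepi.
Qed.

Lemma singular_value_anti (R : realType) p q k l (X : 'M[R[i]]_(p, q)) :
  (k <= l)%N -> singular_value l X <= singular_value k X.
Proof.
move=> kl; rewrite /singular_value; set s := singular_values X.
have [lS|lS] := ltnP l (size s); last first.
  rewrite [s`_l]nth_default //.
  have [kS|kS] := ltnP k (size s); last by rewrite nth_default.
  have := mem_nth 0 kS => /mem_take; rewrite mem_sort => /mapP[i _ ->].
  exact: sqrtr_ge0.
have ss : sorted >=%R s.
  by apply/take_sorted/sort_sorted => x y; exact: ge_total.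
apply: (sorted_leq_nth _ _ 0 ss); rewrite ?inE ?(leq_ltn_trans kl) //.
by move=> y x z xy yz; exact: le_trans yz xy.
by move=> x; exact: lexx.
Qed.

Lemma le_subspace_angle (R : realType) n k l (U V : {vspace 'cV[R[i]]_n}) :
  (k <= l)%N -> subspace_angle k U V <= subspace_angle l U V.
Proof.
move=> kl.
have [U0 V0] := (some_orthonormal_basisP U, some_orthonormal_basisP V).
have angle_mem j : subspace_angle j U V \in `[0, pi].
  have /andP[a0 a1] := subspace_angle_itv j U V.
  rewrite in_itv /= a0 (le_trans a1) //.
  by rewrite ler_pdivrMr // ler_peMr ?pi_ge0 ?ler1n.
rewrite leNgt -ltr_cos // -leNgt !(cos_subspace_angle _ U0 V0).
exact: singular_value_anti.
Qed.

(* Main.v *)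
Require Import Defs.
From mathcomp Require Import all_boot all_order all_algebra spectral complex.
From mathcomp Require Import boolp classical_sets reals trigo.
Import Order.TTheory GRing.Theory Num.Theory.
Local Open Scope ring_scope.
Local Open Scope complex_scope.

(** The efficiency is the quotient [det ((W^* J)^* (W^* J)) / det (J^* J)] of
    two Gram determinants ([efficiencyE]).  Write [J = B X] with [B] an
    orthonormal basis of the range of [J].

    If [J] has full column rank, [X] is square and invertible; the numerator
    is [|det X|^2 det ((W^* B)^* (W^* B))] and the denominator [|det X|^2], so
    the efficiency is the determinant of the Gram matrix of [W^* B].  That
    determinant is the product of the squared singular values of [W^* B]
    ([prod_sqr_singular_value]), and these are the cosines of the angles.

    If [J] is rank deficient, both sides vanish: [J^* J] is singular, and the
    range of [J] has dimension [d < q], so that the factor of index [d] is the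
    cosine of an angle beyond the last canonical one, that is [cos (pi / 2)]. *)

Local Open Scope sesquilinear_scope.

(** The identity covers singular Gram matrices: [invmx] fixes a singular matrix,
    whose determinant is [0], and [0^-1 = 0], so that [det_inv] still holds. *)
Lemma efficiencyE (C : numClosedFieldType) (n m q : nat)
    (W : 'M[C]_(n, m)) (J : 'M[C]_(n, q)) :
  efficiency W J =
    \det ((W^t* *m J)^t* *m (W^t* *m J)) / \det (J^t* *m J).
Proof.
by rewrite /efficiency !det_inv invrK mulrC trmxC_mul trmxCK !mulmxA.
Qed.

Lemma det_normal (C : numClosedFieldType) (n : nat) (A : 'M[C]_n) :
  A \is normalmx -> \det A = \prod_i spectral_diag A 0 i.
Proof.
move=> /orthomx_spectralP {1}->.
have uP := spectral_unit A.
rewrite !det_mulmx det_diag det_inv mulrAC mulVf ?mul1r //.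
by rewrite -unitfE -unitmxE.
Qed.

(** Diagonalising [X^* X] in an orthonormal basis of eigenvectors exhibits its
    eigenvalues as diagonal entries of the Gram matrix of [X P^*], where the
    columns of [P^*] are the eigenvectors. *)
Lemma spectral_diag_gram_ge0 (C : numClosedFieldType) (p q : nat)
    (X : 'M[C]_(p, q)) (i : 'I_q) : 0 <= spectral_diag (X^t* *m X) 0 i.
Proof.
have := orthomx_spectralP (gram_normal X).
set P := spectralmx _; set d := spectral_diag _ => XE.
have uP : P \is unitarymx := spectral_unitarymx _.
rewrite invmx_unitary // in XE.
have PP : P *m P^t* = 1%:M by apply/unitarymxP.
have dE : diag_mx d = (X *m P^t*)^t* *m (X *m P^t*).
  rewrite trmxC_mul trmxCK !mulmxA -(mulmxA P) XE !mulmxA PP mul1mx.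
  by rewrite -mulmxA PP mulmx1.
by have := gram_diag_ge0 (X *m P^t*) i; rewrite -dE mxE eqxx mulr1n.
Qed.

Lemma prod_sqr_singular_value (R : realType) (p q : nat)
    (X : 'M[R[i]]_(p, q)) : (q <= p)%N ->
  (\prod_(k < q) singular_value k X ^+ 2)%:C = \det (X^t* *m X).
Proof.
move=> qp; rewrite det_normal ?gram_normal //.
pose f i := Num.sqrt (complex.Re (spectral_diag (X^t* *m X) 0 i)).
have svE : singular_values X = sort >=%R [seq f i | i <- enum 'I_q].
  rewrite /singular_values (minn_idPr qp) take_oversize //.
  by rewrite size_sort size_map size_enum_ord.
have sz : size (singular_values X) = q.
  by rewrite svE size_sort size_map size_enum_ord.
have -> : \prod_(k < q) singular_value k X ^+ 2 = \prod_i f i ^+ 2.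
  transitivity (\prod_(x <- singular_values X) x ^+ 2).
    by rewrite (big_nth 0) sz big_mkord.
  have svP : perm_eq (singular_values X) [seq f i | i <- enum 'I_q].
    by rewrite svE perm_sort.
  by rewrite (perm_big _ svP) big_map big_enum.
rewrite rmorph_prod; apply: eq_bigr => i _; rewrite /f.
have := spectral_diag_gram_ge0 _ _ _ X i; case: (spectral_diag _ _ _) => a b.
by rewrite lecE /= => /andP[/eqP-> a0]; rewrite sqr_sqrtr.
Qed.

Theorem theorem3p1 (R : realType) (n m q : nat)
    (calW : {vspace 'cV[R[i]]_n}) (W : 'M[R[i]]_(n, m)) (J : 'M[R[i]]_(n, q)) :
  \dim calW = m -> orthonormal_basis calW W -> (q <= m)%N ->
  efficiency W J =
    (\prod_(k < q) cos (subspace_angle k calW (colspace J)) ^+ 2)%:C.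
Proof.
move=> _ WW qm; rewrite efficiencyE.
have [B BJ] := orthonormal_basis_exists (colspace J).
have dq : (\dim (colspace J) <= q)%N.
  by apply: leq_trans (dim_span _) _; rewrite size_tuple.
move: (\dim _) dq B BJ => d dq B BJ; have [BB BE] := BJ.
have [X JE] : exists X, J = B *m X by apply/colspace_sub; rewrite BE.
have [Y BY] : exists Y, B = J *m Y by apply/colspace_sub; rewrite BE.
have gramJ : J^t* *m J = X^t* *m X.
  by rewrite JE trmxC_mul mulmxA -(mulmxA _ (B^t*)) BB mulmx1.
under eq_bigr => k _ do rewrite (cos_subspace_angle k WW BJ).
move: dq; rewrite leq_eqVlt => /orP[/eqP dq|dq]; last first.
  (* [X] has fewer rows than columns, so [X^* X] is singular. *)
  have -> : \det (J^t* *m J) = 0.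
    apply/eqP; rewrite -[_ == 0]negbK -unitfE -unitmxE -row_free_unit gramJ.
    rewrite -row_leq_rank -ltnNge.
    by apply: leq_ltn_trans dq; apply: leq_trans (mulmx_max_rank _ _) _.
  (* [W^* B] has at most [d] singular values: the one of index [d] is the
     default value [0]. *)
  rewrite invr0 mulr0 (bigD1 (Ordinal dq)) //= /singular_value nth_default.
    by rewrite expr0n mul0r.
  by rewrite size_take_min geq_min geq_minr.
subst d.
have XY : X *m Y = 1%:M.
  by rewrite -[LHS]mul1mx -BB -mulmxA (mulmxA B) -JE -BY.
have uX : \det (X^t* *m X) != 0.
  have [uX _] := mulmx1_unit XY.
  rewrite det_mulmx mulf_neq0 -?unitfE -?unitmxE //.
  by rewrite map_unitmx unitmx_tr.
rewrite prod_sqr_singular_value // gramJ JE (mulmxA (W^t*)).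
move: (W^t* *m B) => M.
rewrite trmxC_mul mulmxA -(mulmxA _ (M^t*)).
rewrite !det_mulmx in uX *.
by rewrite [X in X / _]mulrAC [LHS]mulrAC divff // mul1r.
Qed.
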